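(* Let $G$ be a finite group and let $H$ be a proper normal subgroup of $G$. Then $$o(G,H)\geq o(G/H,1)\qquad\text{(i)}$$ and $$\psi''(G,H)\leq\psi''(G/H,1).\qquad\text{(ii)}$$ Assume in addition that $H$ is non-trivial. Then equality holds in (i) if and only if $(G,H)$ is an equal order pair with $H$ an isolated subgroup of $G$; and equality holds in (ii) if and only if one of the following holds: either $G\cong C_{p^n}$ for some prime $p$ and some integer $n\geq 2$, and $H$ is the subgroup $p^{n-i}G\cong C_{p^i}$ (in additive notation, i.e. the unique subgroup of $G$ of order $p^i$) for some $i\in\{1,\dots,n-1\}$; or $G\cong Q_{2^n}$ for some integer $n\geq 3$ and $H=Z(G)\cong C_2$.
   Context: For a finite group $G$, $o(x)$ denotes the order of the element $x\in G$, and $\psi(G)=\sum_{x\in G}o(x)$. For a proper normal subgroup $H$ of $G$ put $$o(G,H)=\frac{\psi(G)-\psi(H)}{|G|-|H|}\quad\text{and}\quad \psi''(G,H)=\frac{\psi(G)-\psi(H)}{|G|^2-|H|^2}.$$ In particular, for the quotient group $G/H$ and its trivial subgroup $1$, $o(G/H,1)=\frac{\psi(G/H)-1}{|G/H|-1}$ and $\psi''(G/H,1)=\frac{\psi(G/H)-1}{|G/H|^2-1}$. The pair $(G,H)$ is called an equal order pair if for every $x\in G\setminus H$ all the elements of the coset $xH$ have the same order as $x$. The subgroup $H$ is called isolated if $\langle x\rangle\cap H=1$ for every $x\in G\setminus H$. $C_k$ denotes the cyclic group of order $k$, and $Q_{2^n}$ ($n\ge 3$) the (generalized) quaternion group of order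 $2^n$. *)

(* Defs.v *)
From HB Require Import structures.
From mathcomp Require Import all_boot all_order all_algebra.
From mathcomp Require Import all_fingroup all_solvable.

Set Implicit Arguments.
Unset Strict Implicit.
Unset Printing Implicit Defensive.

Definition psi (gT : finGroupType) (G : {group gT}) : nat :=
  (\sum_(x in G) #[x]%g)%N.

(* The differences below are taken in [rat], where no truncation occurs; the
   denominators are nonzero as soon as [H] is a proper subgroup of [G]. *)
Definition pair_o (gT : finGroupType) (G H : {group gT}) : rat :=
  (((psi G)%:R - (psi H)%:R) / (#|G|%:R - #|H|%:R))%R.

Definition pair_psi'' (gT : finGroupType) (G H : {group gT}) : rat :=
  (((psi G)%:R - (psi H)%:R) / (#|G|%:R ^+ 2 - #|H|%:R ^+ 2))%R.

Definition equal_order_pair (gT : finGroupType) (G H : {group gT}) : Prop :=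
  forall x : gT, x \in (G :\: H)%g ->
  forall y : gT, y \in (x *: H)%g -> #[y]%g = #[x]%g.

Definition isolated (gT : finGroupType) (G H : {group gT}) : Prop :=
  forall x : gT, x \in (G :\: H)%g -> (<[x]> :&: H)%g = 1%g.

(* Main.v *)
Require Import Defs.
From mathcomp Require Import all_boot all_order all_algebra.
From mathcomp Require Import all_fingroup all_solvable.

(** Everything happens on [G :\: H], by comparing the order of [x] with the
    order of its coset. The subgroup [<[x]>] maps onto [<[coset H x]>] with
    kernel [<[x]> :&: H], so
      [#[x] = #[coset H x] * #|<[x]> :&: H|],
    and therefore [#[coset H x] <= #[x] <= #[coset H x] * #|H|]. The left
    inequality is an equality iff [<[x]>] meets [H] trivially, the right one
    iff [<[x]>] contains [H]. Let [S] and [T] be the sums of [#[x]] and of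
    [#[coset H x]] over [x] in [G :\: H]. Each coset contributes [#|H|] equal
    terms to [T], so [T = #|H| * (psi (G / H) - 1)], while
    [S = psi G - psi H]. After clearing the powers of [#|H|], inequality (i)
    becomes [T <= S] and inequality (ii) becomes [S <= T * #|H|], each over the
    same positive denominator on both sides. Summing the pointwise
    inequalities gives both, and equality of the sums means equality for
    every [x].

    Equality in (i) thus says that [H] is isolated, and then every element
    outside [H] has the order of its coset, which gives the equal order
    condition.

    Equality in (ii) says that every [x] outside [H] generates a subgroup
    containing [H]. For each prime [q] dividing [#|G : H|] there is a
    [q]-element outside [H], which makes [H] a [q]-group; as [H] is
    non-trivial there is only one such [q], and [G] is a [q]-group. It has a
    single subgroup of order [q]: an element of order [q] outside [H] would
    generate a group of prime order containing [H] properly, and [H] is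
    cyclic. Such a [q]-group is cyclic or generalized quaternion.
    In the quaternion case the elements of order dividing 4 generate [G], so
    one of them is outside [H] and [H], being properly contained in a cyclic
    group of order at most 4, has order 2, so it is the centre.
    Conversely, the subgroups of a cyclic [p]-group form a chain, and the
    centre of a quaternion group is its only subgroup of order 2. *)

(** * Order of an element and order of its coset *)

Local Open Scope group_scope.

(** The quotient map sends [<[x]>] onto [<[coset H x]>] with kernel
    [<[x]> :&: H]. *)
Lemma order_coset_capM {gT : finGroupType} {H : {group gT}} {x : gT} :
  x \in 'N(H) -> (#[coset H x] * #|<[x]> :&: H|)%N = #[x].
Proof.
move=> Nx; rewrite /order -quotient_cycle // card_quotient ?cycle_subG //.
by rewrite mulnC -(LagrangeI <[x]> H).
Qed.

Lemma order_coset_leqif {gT : finGroupType} {H : {group gT}} {x : gT} :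
  x \in 'N(H) -> (#[coset H x] <= #[x] ?= iff (<[x]> :&: H == 1)%g)%N.
Proof.
move=> Nx; rewrite -(order_coset_capM Nx); split.
  by rewrite leq_pmulr ?cardG_gt0.
by rewrite -{1}[#[_]]muln1 eqn_pmul2l ?order_gt0 // eq_sym -trivg_card1.
Qed.

Lemma order_leqif_coset {gT : finGroupType} {H : {group gT}} {x : gT} :
  x \in 'N(H) ->
  (#[x] <= #[coset H x] * #|H| ?= iff (H \subset <[x]>))%N.
Proof.
move=> Nx; rewrite -(order_coset_capM Nx); split.
  by rewrite leq_mul2l subset_leq_card ?subsetIr ?orbT.
rewrite eqn_pmul2l ?order_gt0 //; apply/eqP/idP => [eqH | /setIidPr-> //].
by apply/setIidPr/eqP; rewrite eqEcard subsetIr eqH /=.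
Qed.

(** The fibres of [coset H] over [G / H] are cosets, all of size [#|H|]. *)
Lemma sum_coset {gT : finGroupType} {G H : {group gT}}
    (F : coset_of H -> nat) :
  H <| G ->
  (\sum_(x in G) F (coset H x) = \sum_(c in (G / H)%g) F c * #|H|)%N.
Proof.
move=> nHG; rewrite (partition_big (coset H) (mem (G / H))) /=; last first.
  by move=> x Gx; apply: mem_quotient.
apply: eq_bigr => c /morphimP[x Nx Gx ->].
rewrite (eq_bigl (mem (H :* x))) => [|y /=]; last first.
  apply/andP/idP=> [[Gy /eqP eq_yx] | Hx_y].
    apply/rcoset_kercosetP => //; exact: subsetP (normal_norm nHG) y Gy.
  have Gy : y \in G.
    by apply: (subsetP _ y Hx_y); rewrite mul_subG ?(normal_sub nHG) ?sub1set.
  split=> //; apply/eqP/rcoset_kercosetP => //.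
  exact: subsetP (normal_norm nHG) y Gy.
rewrite (eq_bigr (fun=> F (coset H x))) => [|y Hx_y]; last first.
  have Ny : y \in 'N(H).
    by apply: (subsetP _ y Hx_y); rewrite mul_subG ?normG ?sub1set.
  by congr F; apply/rcoset_kercosetP.
by rewrite sum_nat_const card_rcoset mulnC.
Qed.

(** * The two ratios over a common denominator *)

Lemma psiD {gT : finGroupType} {G H : {group gT}} :
  H \subset G -> psi G = (psi H + \sum_(x in G :\: H) #[x])%N.
Proof.
move=> sHG; rewrite /psi (big_setID H) /=; congr (_ + _)%N.
by apply: eq_bigl => x; rewrite (setIidPr sHG).
Qed.

Lemma psi_quotientM {gT : finGroupType} {G H : {group gT}} :
  H <| G ->
  (psi (G / H)%G * #|H| = #|H| + \sum_(x in G :\: H) #[coset H x])%N.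
Proof.
move=> nHG; rewrite /psi big_distrl -(sum_coset _ nHG) (big_setID H) /=.
congr (_ + _)%N; rewrite (setIidPr (normal_sub nHG)) -sum1_card.
by apply: eq_bigr => x Hx; rewrite coset_id ?order1.
Qed.

Lemma psi1 (gT : finGroupType) : psi (1%G : {group gT}) = 1%N.
Proof. by rewrite /psi big_set1 order1. Qed.

Section Ratios.

Import Order.TTheory GRing.Theory Num.Theory.
Local Open Scope ring_scope.

Lemma pair_oE {gT : finGroupType} {G H : {group gT}} :
  H \subset G ->
  pair_o G H = (\sum_(x in (G :\: H)%g) #[x]%g)%N%:R / (#|G|%:R - #|H|%:R).
Proof. by move=> sHG; rewrite /pair_o (psiD sHG) natrD addrAC subrr add0r. Qed.

Lemma pair_psi''E {gT : finGroupType} {G H : {group gT}} :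
  H \subset G ->
  pair_psi'' G H =
    (\sum_(x in (G :\: H)%g) #[x]%g)%N%:R / (#|G|%:R ^+ 2 - #|H|%:R ^+ 2).
Proof.
by move=> sHG; rewrite /pair_psi'' (psiD sHG) natrD addrAC subrr add0r.
Qed.

(** The denominator [d] is left free so that both ratios of [G / H] are
    instances. *)
Lemma quotient_ratioE {gT : finGroupType} {G H : {group gT}} (d : rat) :
  H <| G ->
  ((psi (G / H)%G)%:R - (psi (1%G : {group coset_of H}))%:R) / d =
    (\sum_(x in (G :\: H)%g) #[coset H x]%g)%N%:R / (#|H|%:R * d).
Proof.
move=> nHG; have H0 : #|H|%:R != 0 :> rat by rewrite pnatr_eq0 -lt0n.
rewrite psi1.
have <- : ((psi (G / H)%G)%:R - 1) * #|H|%:R =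
    (\sum_(x in (G :\: H)%g) #[coset H x]%g)%N%:R :> rat.
  by rewrite mulrBl mul1r -natrM psi_quotientM // natrD addrAC subrr add0r.
by rewrite invfM mulrA mulfK.
Qed.

Lemma natr_card_quotient {gT : finGroupType} {G H : {group gT}} :
  H <| G -> #|G|%:R = #|H|%:R * #|(G / H)%g|%:R :> rat.
Proof.
move=> nHG.
by rewrite -natrM card_quotient ?normal_norm // Lagrange ?normal_sub.
Qed.

Lemma pair_o_quotientE {gT : finGroupType} {G H : {group gT}} :
  H <| G ->
  pair_o (G / H)%G 1%G =
    (\sum_(x in (G :\: H)%g) #[coset H x]%g)%N%:R / (#|G|%:R - #|H|%:R).
Proof.
move=> nHG; rewrite /pair_o quotient_ratioE // cards1 (natr_card_quotient nHG).
by rewrite mulrBr mulr1.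
Qed.

Lemma pair_psi''_quotientE {gT : finGroupType} {G H : {group gT}} :
  H <| G ->
  pair_psi'' (G / H)%G 1%G =
    (\sum_(x in (G :\: H)%g) (#[coset H x]%g * #|H|))%N%:R
      / (#|G|%:R ^+ 2 - #|H|%:R ^+ 2).
Proof.
move=> nHG; have H0 : #|H|%:R != 0 :> rat by rewrite pnatr_eq0 -lt0n.
rewrite /pair_psi'' quotient_ratioE // cards1 -big_distrl natrM /=.
rewrite (natr_card_quotient nHG) exprMn expr1n.
rewrite -[X in _ / (_ - X)]mulr1 -mulrBr expr2 -(mulrA _ _ (_ - _)).
by rewrite [in RHS]invfM [in RHS]mulrA mulfK.
Qed.

Lemma pair_o_denom_gt0 {gT : finGroupType} {G H : {group gT}} :
  H \proper G -> 0 < #|G|%:R - #|H|%:R :> rat.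
Proof. by move=> pHG; rewrite subr_gt0 ltr_nat proper_card. Qed.

Lemma pair_psi''_denom_gt0 {gT : finGroupType} {G H : {group gT}} :
  H \proper G -> 0 < #|G|%:R ^+ 2 - #|H|%:R ^+ 2 :> rat.
Proof.
by move=> pHG; rewrite subr_gt0 -!natrX ltr_nat ltn_sqr proper_card.
Qed.

Lemma leqif_natr_div (m n : nat) (b : bool) (d : rat) :
  0 < d -> (m <= n ?= iff b)%N -> m%:R / d <= n%:R / d ?= iff b.
Proof.
move=> d_gt0 [le_mn eq_mn]; split.
  by rewrite ler_pM2r ?invr_gt0 // ler_nat.
have dV0 : d^-1 != 0 by rewrite invr_eq0 gt_eqF.
by rewrite (inj_eq (mulIf dV0)) eqr_nat.
Qed.

Lemma pair_o_leqif {gT : finGroupType} {G H : {group gT}} :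
  H <| G -> H \proper G ->
  pair_o (G / H)%G 1%G <= pair_o G H
    ?= iff [forall (x | x \in (G :\: H)%g), (<[x]> :&: H == 1)%g].
Proof.
move=> nHG pHG; rewrite pair_o_quotientE // pair_oE ?normal_sub //.
apply: leqif_natr_div; first exact: pair_o_denom_gt0.
apply: leqif_sum => x /setDP[Gx _]; apply: order_coset_leqif.
exact: subsetP (normal_norm nHG) x Gx.
Qed.

Lemma pair_psi''_leqif {gT : finGroupType} {G H : {group gT}} :
  H <| G -> H \proper G ->
  pair_psi'' G H <= pair_psi'' (G / H)%G 1%G
    ?= iff [forall (x | x \in (G :\: H)%g), H \subset <[x]>%g].
Proof.
move=> nHG pHG; rewrite pair_psi''_quotientE // pair_psi''E ?normal_sub //.
apply: leqif_natr_div; first exact: pair_psi''_denom_gt0.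
apply: leqif_sum => x /setDP[Gx _]; apply: order_leqif_coset.
exact: subsetP (normal_norm nHG) x Gx.
Qed.

End Ratios.

(** * The equality case of (i) *)

(** For an isolated [H] the kernel of [<[x]> -> <[coset H x]>] is trivial when
    [x] is outside [H], so the order of [x] is read off from its coset. *)
Lemma isolated_equal_order {gT : finGroupType} {G H : {group gT}} :
  H <| G -> isolated G H -> equal_order_pair G H.
Proof.
move=> nHG isoH x GHx y; rewrite -norm_rlcoset; last first.
  by case/setDP: GHx => Gx _; apply: subsetP (normal_norm nHG) x Gx.
move=> Hxy; have [Gx H'x] := setDP GHx.
have Nx := subsetP (normal_norm nHG) x Gx.
have Ny : y \in 'N(H).
  by apply: (subsetP _ y Hxy); rewrite mul_subG ?normG ?sub1set.
have eq_xy : coset H y = coset H x by apply/rcoset_kercosetP.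
have H'y : y \notin H.
  by apply: contra H'x => Hy; apply: coset_idr; rewrite // -eq_xy coset_id.
have Gy : y \in G.
  by apply: (subsetP _ y Hxy); rewrite mul_subG ?(normal_sub nHG) ?sub1set.
have GHy : y \in G :\: H by rewrite inE H'y.
rewrite -(order_coset_capM Ny) -(order_coset_capM Nx) eq_xy.
by rewrite isoH // isoH.
Qed.

(** * The equality case of (ii) *)

(** A Sylow [q]-subgroup of [G] has index prime to [q], hence cannot lie in
    [H]. *)
Lemma pElt_outside {gT : finGroupType} {G H : {group gT}} {q : nat} :
  H \subset G -> prime q -> (q %| #|G : H|)%N ->
  exists2 x, x \in G :\: H & q.-elt x.
Proof.
move=> sHG q_pr q_dv; have [Q sylQ] := Sylow_exists q G.
have [sQG qQ q'GQ] := and3P sylQ.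
have [sQH | /subsetPn[x Qx H'x]] := boolP (Q \subset H); last first.
  exists x; last exact: mem_p_elt qQ Qx.
  by rewrite inE H'x (subsetP sQG).
have := pnat_dvd (dvdn_trans q_dv (indexgS G sQH)) q'GQ.
by rewrite pnatE // !inE eqxx.
Qed.

Definition sub_outer_cycles {gT : finGroupType} (G H : {group gT}) :=
  forall x, x \in G :\: H -> H \subset <[x]>.

(** If the prime [q] divides [#|G : H|], some [q]-element outside [H]
    generates a group containing [H], so [H] is a [q]-group. As [H] is
    non-trivial, this determines [q]. *)
Lemma sub_outer_cycles_pgroup {gT : finGroupType} {G H : {group gT}} :
  H \proper G -> H :!=: 1 -> sub_outer_cycles G H ->
  exists2 p : nat, prime p & p.-group G.
Proof.
move=> pHG ntH sHx_out; have sHG := proper_sub pHG.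
have qH q : prime q -> (q %| #|G : H|)%N -> q.-group H.
  move=> q_pr /(pElt_outside sHG q_pr)[x GHx qx].
  exact: pgroupS (sHx_out x GHx) qx.
have iGH : (1 < #|G : H|)%N by rewrite indexg_gt1 proper_subn.
set p := pdiv #|G : H|; have p_pr : prime p := pdiv_prime iGH.
have pH : p.-group H by apply: qH => //; apply: pdiv_dvd.
exists p => //; rewrite /pgroup -(Lagrange sHG) pnatM -/(pgroup p H) pH /=.
apply/pnatP=> // q q_pr q_dv.
have [q'_pr q'_dv _] := pgroup_pdiv (qH q q_pr q_dv) ntH.
by rewrite !inE; apply: (pnatP p (cardG_gt0 H) pH).
Qed.

(** An element of order [p] outside [H] would generate a group of prime order
    containing [H] properly, which is impossible. So [G] and the cyclic group
    [H] have the same elements of order [p]. *)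
Lemma sub_outer_cycles_Ohm1 {gT : finGroupType} {G H : {group gT}} {p : nat} :
  H \proper G -> H :!=: 1 -> sub_outer_cycles G H -> p.-group G ->
  #|'Ohm_1(G)| = p.
Proof.
move=> pHG ntH sHx_out pG; have sHG := proper_sub pHG.
have [p_pr _ _] := pgroup_pdiv (pgroupS sHG pG) ntH.
have cycH : cyclic H.
  have [_ [x Gx H'x]] := properP pHG.
  by apply: cyclicS (cycle_cyclic x); apply: sHx_out; rewrite inE H'x.
rewrite -(Ohm1_cyclic_pgroup_prime cycH (pgroupS sHG pG) ntH).
congr #|(_ : {set _})|; apply/eqP; rewrite eqEsubset (OhmS 1 sHG) andbT.
rewrite (OhmE 1 pG) gen_subG; apply/subsetP=> x /LdivP[Gx xp1].
suff Hx : x \in H.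
  by rewrite /= (OhmE 1 (pgroupS sHG pG)) mem_gen //; apply/LdivP.
apply: contraR ntH => H'x.
have GHx : x \in G :\: H by rewrite inE H'x.
have ox : prime #[x].
  have: (#[x] %| p)%N by rewrite order_dvdn xp1.
  case/primeP: (p_pr) => _ dvp /dvp /orP[|/eqP->//].
  by rewrite order_eq1 => /eqP x1; rewrite x1 group1 in H'x.
have /primeP[_ dvx] := ox; have sHx := sHx_out x GHx.
have /orP[|eqHx] := dvx _ (cardSg sHx); first by rewrite -trivg_card1.
have /eqP defH : H :==: <[x]> by rewrite eqEcard sHx (eqP eqHx) /=.
by rewrite defH cycle_id in H'x.
Qed.

Lemma cyclic_isog_Zp {gT : finGroupType} {G : {group gT}} {n : nat} :
  (0 < n)%N -> G \isog Zp n <-> cyclic G /\ #|G| = n.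
Proof.
move=> n_gt0; have cycZ : cyclic (Zp n).
  by rewrite /= /Zp; case: ifP => _; rewrite ?Zp_cycle ?cycle_cyclic ?cyclic1.
rewrite isog_sym isog_cyclic_card // card_Zp //.
by split=> [/andP[-> /eqP] | [-> ->]]; rewrite ?eqxx.
Qed.

(** The set of powers written additively as [p ^ (n - i) G]. *)
Definition cyclic_pair {gT : finGroupType} (G H : {group gT}) : Prop :=
  exists p n : nat,
    [/\ prime p, (2 <= n)%N, G \isog Zp (p ^ n)%N
      & exists i : nat,
          [/\ (1 <= i <= n.-1)%N,
              H :=: [set x ^+ (p ^ (n - i))%N | x in G]
            & H \isog Zp (p ^ i)%N]].

Definition quaternion_pair {gT : finGroupType} (G H : {group gT}) : Prop :=
  exists n : nat,
    [/\ (3 <= n)%N, G \isog 'Q_(2 ^ n)%N, H :=: 'Z(G) & H \isog Zp 2].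

Lemma power_set_cycle {gT : finGroupType} (g : gT) (k : nat) :
  [set x ^+ k | x in <[g]>] = <[g ^+ k]>.
Proof.
apply/setP=> y; apply/imsetP/cycleP=> [[x /cycleP[i ->] ->] | [i ->]].
  by exists i; rewrite -!expgM mulnC.
by exists (g ^+ i); rewrite ?mem_cycle // -!expgM mulnC.
Qed.

Lemma proper_cyclic_pgroup_pair {gT : finGroupType} {G H : {group gT}}
    {p : nat} :
  H \proper G -> H :!=: 1 -> prime p -> p.-group G -> cyclic G ->
  cyclic_pair G H.
Proof.
move=> pHG ntH p_pr pG cycG; have sHG := proper_sub pHG.
have [n oG] := p_natP pG; have [i oH] := p_natP (pgroupS sHG pG).
have i_gt0 : (0 < i)%N.
  by rewrite lt0n; apply: contra ntH => /eqP i0; rewrite trivg_card1 oH i0.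
have lt_in : (i < n)%N.
  by rewrite -(ltn_exp2l _ _ (prime_gt1 p_pr)) -oH -oG proper_card.
have pk_gt0 k : (0 < p ^ k)%N by rewrite expn_gt0 prime_gt0.
exists p, n; split=> //; first exact: leq_ltn_trans i_gt0 lt_in.
  exact/cyclic_isog_Zp.
exists i; split; first by rewrite i_gt0 -ltnS (ltn_predK lt_in).
  have /cyclicP[g defG] := cycG; rewrite defG power_set_cycle.
  apply/eqP; rewrite (eq_subG_cyclic cycG) ?defG ?cycleX -?defG //.
  rewrite oH -orderE (orderXexp _ (n := n)) ?subKn ?(ltnW lt_in) //.
  by rewrite orderE -defG.
by apply/cyclic_isog_Zp => //; split=> //; apply: cyclicS cycG.
Qed.

Lemma quaternion_center {gT : finGroupType} {G : {group gT}} {n : nat} :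
  (2 < n)%N -> G \isog 'Q_(2 ^ n)%N ->
  [/\ 2.-group G, #|'Z(G)| = 2, 'Ohm_1(G) = 'Z(G) & 'Ohm_2(G) = G].
Proof.
move=> n_gt2 isoG; have [[x y] genG _] := generators_quaternion n_gt2 isoG.
have [_ _ [-> oZ _ [-> ->] _] _ _] := quaternion_structure n_gt2 genG isoG.
split=> //; rewrite /pgroup (card_isog isoG) card_quaternion //.
by rewrite pnatX.
Qed.

(** Since ['Ohm_2(G) = G], some [x] with [x ^+ 4 = 1] lies outside [H]; then [H]
    is a proper subgroup of [<[x]>], and so has order 2. *)
Lemma sub_outer_cycles_quaternion {gT : finGroupType} {G H : {group gT}}
    {n : nat} :
  H \proper G -> H :!=: 1 -> sub_outer_cycles G H ->
  (2 < n)%N -> G \isog 'Q_(2 ^ n)%N -> quaternion_pair G H.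
Proof.
move=> pHG ntH sHx_out n_gt2 isoG; have sHG := proper_sub pHG.
have [pG oZ Ohm1G Ohm2G] := quaternion_center n_gt2 isoG.
have [x GHx x4] : exists2 x, x \in G :\: H & x ^+ 4 = 1.
  have /subsetPn[x /LdivP[Gx x4] H'x] : ~~ ('Ldiv_(2 ^ 2)(G) \subset H).
    by rewrite -gen_subG -(OhmE 2 pG) Ohm2G proper_subn.
  by exists x => //; rewrite inE H'x.
have [Gx H'x] := setDP GHx; have sHx := sHx_out x GHx.
have oH : #|H| = 2.
  have ltHx : (#|H| < #[x])%N.
    rewrite proper_card // properE sHx.
    by apply: contra H'x => /subsetP; apply; apply: cycle_id.
  have ox4 : (#[x] %| 2 ^ 2)%N by rewrite order_dvdn x4.
  have [k] := p_natP (pgroupS sHG pG).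
  case: k => [|[|k]] oH; first by rewrite trivg_card1 oH in ntH.
    by rewrite oH.
  have := leq_trans ltHx (dvdn_leq (isT : 0 < 2 ^ 2)%N ox4).
  by rewrite oH ltnNge leq_exp2l.
have defH : H :=: 'Z(G).
  apply/eqP; rewrite eqEcard oZ oH leqnn andbT -Ohm1G (OhmE 1 pG).
  apply/subsetP=> h Hh; apply/mem_gen/LdivP; split; first exact: subsetP Hh.
  by rewrite -[RHS](expg_cardG Hh) oH.
exists n; split=> //; apply/cyclic_isog_Zp => //.
by split=> //; apply: prime_cyclic; rewrite oH.
Qed.

(** Subgroups of a cyclic [p]-group are compared by their orders, hence form a
    chain. *)
Lemma cyclic_pair_sub_outer_cycles {gT : finGroupType} {G H : {group gT}} :
  H \subset G -> cyclic_pair G H -> sub_outer_cycles G H.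
Proof.
move=> sHG [p [n [p_pr _ isoG _]]] x /setDP[Gx H'x].
have /cyclic_isog_Zp[|cycG oG] := isoG; first by rewrite expn_gt0 prime_gt0.
have pG : p.-group G by rewrite /pgroup oG pnatX pnat_id.
have sxG : <[x]> \subset G by rewrite cycle_subG.
have [i oH] := p_natP (pgroupS sHG pG).
have [j ox] := p_natP (pgroupS sxG pG).
rewrite -(cardSg_cyclic cycG) // oH ox dvdn_exp2l // leqNgt.
apply: contra H'x => /ltnW le_ji.
by rewrite -cycle_subG -(cardSg_cyclic cycG) // oH ox dvdn_exp2l.
Qed.

(** A non-trivial subgroup of a generalized quaternion group contains an
    involution, and the centre contains the only one. *)
Lemma quaternion_pair_sub_outer_cycles {gT : finGroupType}
    {G H : {group gT}} :
  quaternion_pair G H -> sub_outer_cycles G H.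
Proof.
move=> [n [n_gt2 isoG defH _]] x /setDP[Gx H'x].
have [pG oZ Ohm1G _] := quaternion_center n_gt2 isoG.
have sxG : <[x]> \subset G by rewrite cycle_subG.
have ntx : <[x]> != 1.
  by rewrite cycle_eq1; apply: contra H'x => /eqP->.
have oOhm :=
  Ohm1_cyclic_pgroup_prime (cycle_cyclic x) (pgroupS sxG pG) ntx.
rewrite defH -Ohm1G; have /eqP <- : 'Ohm_1(<[x]>) == 'Ohm_1(G).
  by rewrite eqEcard OhmS //= Ohm1G oZ oOhm.
exact: Ohm_sub.
Qed.

(** The forward direction rests on the theorem that a [p]-group with a single
    subgroup of order [p] is cyclic or generalized quaternion. *)
Lemma sub_outer_cycles_classification {gT : finGroupType}
    {G H : {group gT}} :
  H \proper G -> H :!=: 1 ->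
  sub_outer_cycles G H <-> cyclic_pair G H \/ quaternion_pair G H.
Proof.
move=> pHG ntH; have sHG := proper_sub pHG; split=> [sHx_out | ].
  have [p p_pr pG] := sub_outer_cycles_pgroup pHG ntH sHx_out.
  have ntG : G :!=: 1 by apply: contra ntH => /eqP G1; rewrite -subG1 -G1.
  have oG1 := sub_outer_cycles_Ohm1 pHG ntH sHx_out pG.
  have /orP[cycG | /andP[_ /eqP/quaternion_classP[n n_gt2 isoG]]] :=
    introT (prime_Ohm1P pG ntG) oG1.
    by left; apply: proper_cyclic_pgroup_pair pG cycG.
  by right; apply: sub_outer_cycles_quaternion n_gt2 isoG.
case; first exact: cyclic_pair_sub_outer_cycles.
exact: quaternion_pair_sub_outer_cycles.
Qed.

Theorem theorem1p1 (gT : finGroupType) (G H : {group gT})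
    (nHG : H <| G) (pHG : H \proper G) :
  [/\ (pair_o G H >= pair_o (G / H)%G 1%G)%R,
      (pair_psi'' G H <= pair_psi'' (G / H)%G 1%G)%R
    & H :!=: 1 ->
      (pair_o G H = pair_o (G / H)%G 1%G <->
         equal_order_pair G H /\ isolated G H)
      /\
      (pair_psi'' G H = pair_psi'' (G / H)%G 1%G <->
         (exists p n : nat,
            [/\ prime p, (2 <= n)%N, G \isog Zp (p ^ n)%N
              & exists i : nat,
                  [/\ (1 <= i <= n.-1)%N,
                      H :=: [set x ^+ (p ^ (n - i))%N | x in G]
                    & H \isog Zp (p ^ i)%N]])
         \/
         (exists n : nat,
            [/\ (3 <= n)%N, G \isog 'Q_(2 ^ n)%N, H :=: 'Z(G)
              & H \isog Zp 2]))].
Proof.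
have [le_o eq_o] := pair_o_leqif nHG pHG.
have [le_psi eq_psi] := pair_psi''_leqif nHG pHG.
split=> // ntH; split.
  split=> [/esym/eqP | [_ isoH]].
    rewrite eq_o => /forall_inP isoH'.
    have isoH : isolated G H by move=> x /isoH'/eqP.
    by split=> //; apply: isolated_equal_order.
  by apply/esym/eqP; rewrite eq_o; apply/forall_inP => x /isoH/eqP.
rewrite -[X in _ <-> X]/(cyclic_pair G H \/ quaternion_pair G H).
apply: iff_trans (sub_outer_cycles_classification pHG ntH).
split=> [/eqP | sHx_out]; first by rewrite eq_psi => /forall_inP.
by apply/eqP; rewrite eq_psi; apply/forall_inP.
Qed.
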